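(* $n(3,5)=18$, $n(4,6)=37$, $27\le n(3,6)\le 28$, $74\le n(5,7)\le 75$, and $150\le n(6,8)\le 151$.
   Context: A standard box in $\mathbb{R}^d$ is a set $K=K_1\times\cdots\times K_d$ where each $K_i\subseteq\mathbb{R}$ is a closed interval. A finite family of $d$-dimensional standard boxes in $\mathbb{R}^d$ is called $k$-neighborly if the dimension of the intersection of any two distinct members is in $\{d-k,d-k+1,\ldots,d-1\}$ (in particular the intersection is nonempty). For positive integers $1\le k\le d$, $n(k,d)$ is the maximum number of members of a $k$-neighborly family of $d$-dimensional standard boxes in $\mathbb{R}^d$. *)

(* Defs.v *)
From HB Require Import structures.
From mathcomp Require Import all_boot all_order all_algebra.
From mathcomp Require Import all_classical reals.

Set Implicit Arguments.
Unset Strict Implicit.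
Unset Printing Implicit Defensive.
Import Order.TTheory GRing.Theory Num.Theory.
Local Open Scope classical_set_scope.
Local Open Scope ring_scope.

Definition closed_interval (R : realType) (I : set R) : Prop :=
  exists a b : R, a <= b /\ I = `[a, b]%classic.

(* Sides may be degenerate here; being d-dimensional is a separate condition
   on the members of a family. *)
Definition standard_box (R : realType) (d : nat) (K : set 'rV[R]_d) : Prop :=
  exists I : 'I_d -> set R,
    (forall i, closed_interval (I i)) /\
    K = [set x : 'rV[R]_d | forall i, I i (x ord0 i)].

(* A is nonempty and its affine hull has dimension j: V is the least linear
   subspace containing all differences of points of A, i.e. the direction of
   the affine hull. The empty set has no dimension. *)
Definition has_dim (R : realType) (d : nat) (A : set 'rV[R]_d) (j : nat)
    : Prop :=
  A !=set0 /\
  exists V : {vspace 'rV[R]_d},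
    [/\ forall x y, A x -> A y -> x - y \in V,
        forall W : {vspace 'rV[R]_d},
          (forall x y, A x -> A y -> x - y \in W) -> (V <= W)%VS
      & \dim V = j].

Definition neighborly (R : realType) (k d : nat) (F : set (set 'rV[R]_d))
    : Prop :=
  [/\ finite_set F,
      forall K, F K -> standard_box K /\ has_dim K d
    & forall K L, F K -> F L -> K <> L ->
        exists j : nat, (d - k <= j <= d - 1)%N /\ has_dim (K `&` L) j].

Definition neighborly_size (R : realType) (k d m : nat) : Prop :=
  exists F : set (set 'rV[R]_d), neighborly k F /\ (F #= `I_m)%card.

Definition is_max_size (R : realType) (k d m : nat) : Prop :=
  neighborly_size R k d m /\
  forall m', neighborly_size R k d m' -> (m' <= m)%N.

(* n(k,d). The default value 0 is never a genuine maximum, since one box alone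
   is a neighborly family; so max_neighborly R k d = m with m > 0 says that
   the maximum exists and equals m. *)
Definition max_neighborly (R : realType) (k d : nat) : nat :=
  xget 0%N [set m | is_max_size R k d m].

(* Main.v *)
(** Pairwise meeting boxes are encoded by words over {0, 1, *}:
in each direction all the contacts take place at a single point, and a side is
labelled 0 if it ends there, 1 if it starts there and * otherwise. The codimension
of the intersection of two boxes is then the number of clashes 0/1 of their words,
so a k-neighborly family amounts to a set of words with between 1 and k clashes
pairwise; these words are pairwise disjoint subcubes of the d-cube.

Upper bounds, with t = d - k: the antipode of a point of a p-dimensional subcube
never lies in a q-dimensional one if p + q < t. Writing W_q for the number of points
in subcubes of dimension at most q, this gives W_p + W_q <= 2^d, whence
4n <= 2 * 2^d + W_0 if t = 2 and 8n <= 3 * 2^d + 3 * W_0 if t = 3. The points counted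
by W_0 have mutual distances at most d - t, so their antipodes avoid their
(t-1)-neighbourhood, and W_0 is bounded by vertex isoperimetry in the cube
(this is Kleitman's diameter theorem).

Lower bounds: 37 and 150 come from a code on Q_(d-2) x Q_2 adapted to the layers of
Q_(d-2), for which all these inequalities are nearly tight; 18, 27 and 74 come from
products. *)
Require Import Defs.
From mathcomp Require Import all_boot all_order all_algebra.
From mathcomp Require Import all_classical reals.
From mathcomp Require Import zify lra.

Set Implicit Arguments.
Unset Strict Implicit.
Unset Printing Implicit Defensive.
Import Order.TTheory GRing.Theory Num.Theory.

Local Notation vertex d := {ffun 'I_d -> bool}.

(** * Hamming distance and antipodes in the discrete cube *)

Section Cube.
Variable d : nat.
Implicit Types (x y z : vertex d) (F : {set vertex d}).

Definition hdist x y : nat := \sum_(i < d) (x i != y i).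

Definition antipode x : vertex d := [ffun i => ~~ x i].

Definition nbhd F : {set vertex d} := [set x | [exists y in F, hdist x y <= 1]].

Lemma hdistxx x : hdist x x = 0.
Proof. by rewrite /hdist big1 // => i _; rewrite eqxx. Qed.

Lemma hdistC x y : hdist x y = hdist y x.
Proof. by apply: eq_bigr => i _; rewrite eq_sym. Qed.

Lemma hdist_triangle y x z : hdist x z <= hdist x y + hdist y z.
Proof.
rewrite /hdist -big_split /=; apply: leq_sum => i _.
by case: (x i) (y i) (z i) => [] [] [].
Qed.

Lemma hdist_antipode x : hdist x (antipode x) = d.
Proof.
rewrite /hdist (eq_bigr (fun=> 1)) ?sum1_card ?card_ord // => i _.
by rewrite ffunE; case: (x i).
Qed.

Lemma antipodeK : involutive antipode.
Proof. by move=> x; apply/ffunP => i; rewrite !ffunE negbK. Qed.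

(** As [antipode] is injective, the antipodes of [A] form a set of size [#|A|] disjoint from [B]. *)
Lemma card_antipode_disjoint (A B : {set vertex d}) :
  {in A, forall x, antipode x \notin B} -> #|A| + #|B| <= 2 ^ d.
Proof.
move=> AB; rewrite -(card_imset (mem A) (inv_inj antipodeK)).
rewrite -cardsUI (_ : _ :&: _ = finset.set0) ?cards0 ?addn0.
  by apply: leq_trans (max_card _) _; rewrite card_ffun card_bool card_ord.
apply/setP => y; rewrite !inE; apply/negP => /andP[/imsetP[x xA ->]].
exact/negP/AB.
Qed.

Lemma iter_nbhdP r F y :
  y \in iter r nbhd F -> exists2 z, z \in F & hdist z y <= r.
Proof.
elim: r y => [|r IH] y /=; first by exists y; rewrite ?hdistxx.
rewrite inE => /exists_inP[y' /IH[z zF zy'] yy']; exists z => //.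
apply: leq_trans (hdist_triangle y' _ _) _.
by rewrite -addn1 leq_add // hdistC.
Qed.

(* A vertex at distance less than t from F is not the antipode of a vertex
   of F. *)
Lemma card_diameter_nbhd k t F : 0 < t -> k + t = d ->
    {in F &, forall x y, hdist x y <= k} ->
  #|F| + #|iter t.-1 nbhd F| <= 2 ^ d.
Proof.
move=> t0 ktd diam; apply: card_antipode_disjoint => x xF.
apply/negP => /iter_nbhdP[z zF].
have := hdist_triangle z x (antipode x); rewrite hdist_antipode.
by have := diam _ _ xF zF; lia.
Qed.

End Cube.

(** * Vertex isoperimetry, by induction through two opposite facets *)

Section Sections.
Variable d : nat.
Implicit Types (x y : vertex d) (F : {set vertex d.+1}).

Definition vcons b x : vertex d.+1 := [ffun i => oapp x b (unlift ord0 i)].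

Definition slice b F : {set vertex d} := [set x | vcons b x \in F].

Lemma hdist_vcons b c x y :
  hdist (vcons b x) (vcons c y) = (b != c) + hdist x y.
Proof.
rewrite /hdist big_ord_recl !ffunE !unlift_none /=; congr (_ + _).
by apply: eq_bigr => i _; rewrite !ffunE !liftK.
Qed.

Lemma vcons_bij : bijective (fun p : bool * vertex d => vcons p.1 p.2).
Proof.
exists (fun x : vertex d.+1 => (x ord0, [ffun i => x (lift ord0 i)])).
  case=> b x /=; rewrite ffunE unlift_none /=; congr pair.
  by apply/ffunP => i; rewrite !ffunE liftK.
move=> x; apply/ffunP => i; rewrite ffunE /=.
by case: unliftP => [j ->|->] /=; rewrite ?ffunE.
Qed.

Lemma card_slices F : #|F| = #|slice true F| + #|slice false F|.
Proof.
rewrite -[#|F|]sum1_card (reindex _ (onW_bij _ vcons_bij)) /=.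
rewrite -(pair_big_dep xpredT (fun b x => vcons b x \in F) (fun _ _ => 1)) /=.
rewrite big_bool /=; congr (_ + _); rewrite -sum1_card; apply: eq_bigl => x;
by rewrite inE.
Qed.

Lemma nbhd_slice b F : nbhd (slice b F) \subset slice b (nbhd F).
Proof.
apply/fintype.subsetP => x; rewrite !inE => /exists_inP[y]; rewrite inE => yF xy.
by apply/exists_inP; exists (vcons b y); rewrite // hdist_vcons eqxx.
Qed.

Lemma slice_nbhd b F : slice (~~ b) F \subset slice b (nbhd F).
Proof.
apply/fintype.subsetP => x; rewrite !inE => xF.
apply/exists_inP; exists (vcons (~~ b) x) => //.
by rewrite hdist_vcons hdistxx; case: b {xF}.
Qed.

End Sections.

(* Entry f bounds from below the size of the closed neighbourhood of f vertices
   of the d-cube: if a of them lie in the first facet, its part of the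
   neighbourhood contains the neighbourhood of these a vertices and the
   projection of the other f - a, and symmetrically for the opposite facet. *)
Fixpoint nbhd_bounds d : seq nat :=
  if d is d'.+1 then
    let L := nbhd_bounds d' in
    [seq foldr minn (2 ^ d)
           [seq maxn (nth 0 L a) (f - a) + maxn (nth 0 L (f - a)) a
             | a <- iota 0 f.+1 & (a <= 2 ^ d') && (f - a <= 2 ^ d')]
      | f <- iota 0 (2 ^ d).+1]
  else [:: 0; 1].

Lemma foldr_minn_le m (s : seq nat) n : n \in s -> foldr minn m s <= n.
Proof.
elim: s => //= a s IH; rewrite inE => /predU1P[->|/IH]; first exact: geq_minl.
by apply: leq_trans; exact: geq_minr.
Qed.

Lemma card_vertex_le d (F : {set vertex d}) : #|F| <= 2 ^ d.
Proof. by apply: leq_trans (max_card _) _; rewrite card_ffun card_bool card_ord. Qed.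

Lemma nbhd_bounds_le d (F : {set vertex d}) :
  nth 0 (nbhd_bounds d) #|F| <= #|nbhd F|.
Proof.
elim: d F => [|d IH] F.
  have sub : F \subset nbhd F.
    apply/fintype.subsetP => x xF; rewrite inE; apply/exists_inP; exists x => //.
    by rewrite hdistxx.
  apply: leq_trans (subset_leq_card sub).
  (* In dimension 0 the table is the identity on the two possible sizes 0 and 1. *)
  by have := card_vertex_le F; case: #|F| => [|[]].
have sz := card_vertex_le F.
cbn [nbhd_bounds]; rewrite (nth_map 0) ?size_iota // nth_iota // add0n.
set L := nbhd_bounds d; set s0 := slice true F; set s1 := slice false F.
have E : #|F| = #|s0| + #|s1| := card_slices F.
have half b : maxn (nth 0 L #|slice b F|) #|slice (~~ b) F|
              <= #|slice b (nbhd F)|.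
  rewrite geq_max (subset_leq_card (slice_nbhd _ _)) andbT.
  exact: leq_trans (IH _) (subset_leq_card (nbhd_slice _ _)).
rewrite (card_slices (nbhd F)); apply: leq_trans (leq_add (half true) (half false)).
rewrite -/s0 -/s1; apply: foldr_minn_le; apply/mapP; exists #|s0|.
  by rewrite mem_filter mem_iota E addKn !card_vertex_le /= add0n ltnS leq_addr.
by rewrite E addKn.
Qed.

(** Combines [card_diameter_nbhd] at t = 2 with the table: a finite check over all sizes then bounds
    [#|F|]. *)
Lemma card_diameter2 k m (F : {set vertex k.+2}) :
    (let L := nbhd_bounds k.+2 in
     all (fun f => (f + nth 0 L f <= 2 ^ k.+2) ==> (f <= m))
       (iota 0 (2 ^ k.+2).+1)) ->
    {in F &, forall x y, hdist x y <= k} ->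
  #|F| <= m.
Proof.
move=> /allP chk diam; have := chk #|F|.
rewrite mem_iota ltnS card_vertex_le => /(_ isT) /implyP; apply.
apply: leq_trans (card_diameter_nbhd (t := 2) _ _ diam) => //.
  by rewrite leq_add2l nbhd_bounds_le.
exact: addn2.
Qed.

(** At t = 3 the neighbourhood is taken twice. Monotonicity of the table is not established, so the
    check runs over every possible size [g] of the first neighbourhood. *)
Lemma card_diameter3 k m (F : {set vertex k.+3}) :
    (let L := nbhd_bounds k.+3 in let s := iota 0 (2 ^ k.+3).+1 in
     all (fun f => all (fun g =>
       (nth 0 L f <= g) && (f + nth 0 L g <= 2 ^ k.+3) ==> (f <= m)) s) s) ->
    {in F &, forall x y, hdist x y <= k} ->
  #|F| <= m.
Proof.
move=> /allP chk diam; have := chk #|F|.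
rewrite mem_iota ltnS card_vertex_le => /(_ isT) /allP /(_ #|nbhd F|).
rewrite mem_iota ltnS card_vertex_le nbhd_bounds_le => /(_ isT) /implyP; apply.
apply: leq_trans (card_diameter_nbhd (t := 3) _ _ diam) => //.
  by rewrite leq_add2l nbhd_bounds_le.
exact: addn3.
Qed.

(** * Words, their clashes and their subcubes *)

Definition clash (a b : option bool) : bool :=
  if (a, b) is (Some a', Some b') then a' != b' else false.

(* None is the letter *. *)
Local Notation word d := ('I_d -> option bool).

Section Words.
Variable d : nat.
Implicit Types (u v : word d) (x y : vertex d).

Definition clashes u v : nat := \sum_(i < d) clash (u i) (v i).

Definition stars u : nat := #|[pred i | u i == None]|.

(** Written as a [family] so that its cardinality is a product over the coordinates. *)
Definition subcube u : {set vertex d} :=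
  [set x in family (fun i =>
    (if u i is Some b then pred1 b else predT) : simpl_pred bool)].

Lemma subcubeP u x :
  reflect (forall i b, u i = Some b -> x i = b) (x \in subcube u).
Proof.
rewrite inE; apply: (iffP familyP) => h i; last first.
  by case E: (u i) => [b|] //; rewrite inE (h i b E).
by move=> b E; have := h i; rewrite E inE => /eqP.
Qed.

Lemma card_subcube u : #|subcube u| = 2 ^ stars u.
Proof.
rewrite /subcube cardsE card_family foldrE big_map big_enum /=.
rewrite /stars -sum1_card expn_sum [RHS]big_mkcond /=; apply: eq_bigr => i _.
by rewrite !inE; case: (u i) => [b|] /=; rewrite ?card1 ?card_bool.
Qed.

Lemma clashesxx u : clashes u u = 0.
Proof. by apply: big1 => i _; case: (u i) => //= -[]. Qed.

Lemma clashes_leq u v : clashes u v <= d.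
Proof. by rewrite -[leqRHS]card_ord -sum1_card; apply: leq_sum => i _; exact: leq_b1. Qed.

Lemma starsE u : stars u = \sum_(i < d) (u i == None).
Proof.
by rewrite /stars -sum1_card big_mkcond; apply: eq_bigr => i _; rewrite inE; case: eqP.
Qed.

(** A coordinate where [x] and [y] differ is a clash or carries a star in [u] or in [v]. *)
Lemma hdist_subcubes u v x y : x \in subcube u -> y \in subcube v ->
  hdist x y <= clashes u v + (stars u + stars v).
Proof.
move=> /subcubeP xu /subcubeP yv.
rewrite !starsE -!big_split; apply: leq_sum => i _.
case ui: (u i) => [a|]; case vi: (v i) => [b|] //=; try exact: leq_b1.
  by rewrite (xu _ _ ui) (yv _ _ vi) !addn0.
by case: (_ != _).
Qed.

Lemma clashes_disjoint u v x : 0 < clashes u v -> x \in subcube u ->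
  x \notin subcube v.
Proof.
move=> uv /subcubeP xu; apply/negP => /subcubeP xv.
move: uv; rewrite /clashes big1 // => i _.
case ui: (u i) => [a|] //=; case vi: (v i) => [b|] //=.
by rewrite /clash -(xu _ _ ui) -(xv _ _ vi) eqxx.
Qed.

End Words.

(** * Weight inequalities and upper bounds for codes *)

Definition neighborly_code k d n (w : 'I_n -> word d) : Prop :=
  forall i j, i != j -> 1 <= clashes (w i) (w j) <= k.

Section Code.
Variables (k d n : nat) (w : 'I_n -> word d).
Hypothesis code : neighborly_code k w.

Definition covered (P : pred 'I_n) : {set vertex d} :=
  \bigcup_(i | P i) subcube (w i).

(** Distinct words clash, so their subcubes are disjoint and the sizes add up. *)
Lemma card_covered P : #|covered P| = \sum_(i | P i) 2 ^ stars (w i).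
Proof.
rewrite /covered big_mkcond -sum1_card partition_disjoint_bigcup /=.
  rewrite [RHS]big_mkcond; apply: eq_bigr => i _; rewrite sum1_card.
  by case: ifP; rewrite ?card_subcube ?cards0.
move=> i j ij; apply/pred0P => x /=; apply/negP => /andP[].
case: (P i); last by rewrite inE.
case: (P j); last by rewrite finset.in_set0.
by move=> xi; apply/negP/clashes_disjoint/xi; case/andP: (code ij).
Qed.

Lemma sum_subcubes : \sum_i 2 ^ stars (w i) <= 2 ^ d.
Proof. by rewrite -card_covered card_vertex_le. Qed.

Definition weight q := \sum_(i | stars (w i) <= q) 2 ^ stars (w i).

Lemma clashes_le i j : clashes (w i) (w j) <= k.
Proof.
by have [->|/code/andP[]//] := eqVneq i j; rewrite clashesxx.
Qed.

Lemma hdist_covered p q x y :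
    x \in covered (fun i => stars (w i) <= p) ->
    y \in covered (fun i => stars (w i) <= q) ->
  hdist x y <= k + (p + q).
Proof.
move=> /bigcupP[i ip xi] /bigcupP[j jq yj].
apply: leq_trans (hdist_subcubes xi yj) _.
by rewrite !leq_add ?clashes_le.
Qed.

Lemma weight_antipodal p q : k + (p + q) < d -> weight p + weight q <= 2 ^ d.
Proof.
move=> lt_d; rewrite /weight -!card_covered; apply: card_antipode_disjoint => x xp.
apply/negP => /(hdist_covered xp); rewrite hdist_antipode; lia.
Qed.

Lemma weight_sum q : weight q = \sum_i (stars (w i) <= q) * 2 ^ stars (w i).
Proof.
by rewrite /weight big_mkcond; apply: eq_bigr => i _; case: (_ <= _); rewrite ?mul1n.
Qed.

End Code.

Lemma code_size2 k m n (w : 'I_n -> word k.+2) :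
    neighborly_code k w ->
    (let L := nbhd_bounds k.+2 in
     all (fun f => (f + nth 0 L f <= 2 ^ k.+2) ==> (f <= m))
       (iota 0 (2 ^ k.+2).+1)) ->
  4 * n <= 2 * 2 ^ k.+2 + m.
Proof.
move=> code chk.
have w0 : weight w 0 <= m.
  rewrite /weight -(card_covered code); apply: card_diameter2 chk _ => x y xF yF.
  by have := hdist_covered code xF yF; rewrite !addn0.
have w01 : weight w 0 + weight w 1 <= 2 ^ k.+2.
  by apply: (weight_antipodal code); lia.
have tot := sum_subcubes code.
(* Each word contributes at least 4 to the right: 1 + 2 + 1 with no star, 2 + 2 with one star, and
   [2 ^ s] with s >= 2 stars. *)
suff le_n : 4 * n <= \sum_i 2 ^ stars (w i) + (weight w 0 + weight w 1) + weight w 0.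
  by apply: leq_trans le_n _; lia.
rewrite !weight_sum -!big_split /= mulnC -[n in n * _]card_ord -sum_nat_const.
apply: leq_sum => i _.
case: (stars (w i)) => [|[|s]] //=; rewrite !expnS; have := expn_gt0 2 s; lia.
Qed.

Lemma code_size3 k m n (w : 'I_n -> word k.+3) :
    neighborly_code k w ->
    (let L := nbhd_bounds k.+3 in let s := iota 0 (2 ^ k.+3).+1 in
     all (fun f => all (fun g =>
       (nth 0 L f <= g) && (f + nth 0 L g <= 2 ^ k.+3) ==> (f <= m)) s) s) ->
  8 * n <= 3 * 2 ^ k.+3 + 3 * m.
Proof.
move=> code chk.
have w0 : weight w 0 <= m.
  rewrite /weight -(card_covered code); apply: card_diameter3 chk _ => x y xF yF.
  by have := hdist_covered code xF yF; rewrite !addn0.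
have w02 : weight w 0 + weight w 2 <= 2 ^ k.+3.
  by apply: (weight_antipodal code); lia.
have w11 : weight w 1 + weight w 1 <= 2 ^ k.+3.
  by apply: (weight_antipodal code); lia.
have tot := sum_subcubes code.
(* Each word contributes at least 8: 1 + 2 + 2 + 3 with no star, 2 + 2 + 4 with one, 4 + 4 with two,
   and [2 ^ s] with s >= 3. *)
suff le_n : 8 * n <= \sum_i 2 ^ stars (w i) + (weight w 0 + weight w 2)
                     + (weight w 1 + weight w 1)
                     + (weight w 0 + (weight w 0 + weight w 0)).
  by apply: leq_trans le_n _; lia.
rewrite !weight_sum -!big_split /= mulnC -[n in n * _]card_ord -sum_nat_const.
apply: leq_sum => i _.
case: (stars (w i)) => [|[|[|s]]] //=; rewrite !expnS; have := expn_gt0 2 s; lia.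
Qed.

Lemma code_size_3_5 n (w : 'I_n -> word 5) : neighborly_code 3 w -> n <= 18.
Proof.
(* Here 10 = 2 (1 + 4) is Kleitman's maximum for diameter 3 in the 5-cube; 22, 12, 44 and 93 below
   arise in the same way. *)
move=> /(@code_size2 3 10) size_le.
suff: 4 * n <= 74 by lia.
by apply: size_le; vm_cast_no_check (erefl true).
Qed.

Lemma code_size_4_6 n (w : 'I_n -> word 6) : neighborly_code 4 w -> n <= 37.
Proof.
move=> /(@code_size2 4 22) size_le.
suff: 4 * n <= 150 by lia.
by apply: size_le; vm_cast_no_check (erefl true).
Qed.

Lemma code_size_3_6 n (w : 'I_n -> word 6) : neighborly_code 3 w -> n <= 28.
Proof.
move=> /(@code_size3 3 12) size_le.
suff: 8 * n <= 228 by lia.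
by apply: size_le; vm_cast_no_check (erefl true).
Qed.

Lemma code_size_5_7 n (w : 'I_n -> word 7) : neighborly_code 5 w -> n <= 75.
Proof.
move=> /(@code_size2 5 44) size_le.
suff: 4 * n <= 300 by lia.
by apply: size_le; vm_cast_no_check (erefl true).
Qed.

Lemma code_size_6_8 n (w : 'I_n -> word 8) : neighborly_code 6 w -> n <= 151.
Proof.
move=> /(@code_size2 6 93) size_le.
suff: 4 * n <= 605 by lia.
by apply: size_le; vm_cast_no_check (erefl true).
Qed.

(** * Explicit codes, checked by computation *)

Definition list_code k d (C : seq (seq (option bool))) : bool :=
  all (fun u => size u == d) C &&
  pairwise (fun u v => 1 <= count (fun p => clash p.1 p.2) (zip u v) <= k) C.

Lemma count_clash d (u v : seq (option bool)) : size u = d -> size v = d ->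
  count (fun p => clash p.1 p.2) (zip u v)
    = clashes (fun i : 'I_d => nth None u i) (fun i : 'I_d => nth None v i).
Proof.
elim: d u v => [|d IH] [|a u] [|b v] //=; first by rewrite /clashes big_ord0.
by move=> [su] [sv]; rewrite /clashes big_ord_recl /= (IH u v).
Qed.

Lemma clashesC d (u v : word d) : clashes u v = clashes v u.
Proof.
apply: eq_bigr => i _; rewrite /clash.
by case: (u i) (v i) => [a|] [b|] //; rewrite eq_sym.
Qed.

Lemma list_codeP k d n C : list_code k d C -> size C = n ->
  exists w : 'I_n -> word d, neighborly_code k w.
Proof.
move=> /andP[/allP sz /(pairwiseP [::]) pw] sC.
exists (fun i l => nth None (nth [::] C i) l) => i j ij.
have szn (l : 'I_n) : size (nth [::] C l) = d.
  by apply/eqP/sz; rewrite mem_nth // sC.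
wlog lt_ij : i j ij / i < j => [wl|].
  have /orP[/wl|/wl] : (i < j) || (j < i) by rewrite -neq_ltn.
    exact.
  by rewrite clashesC eq_sym; apply.
rewrite -count_clash //; apply: pw => //; rewrite inE sC; exact: ltn_ord.
Qed.

(** Clashes add under concatenation, so sizes multiply while both [k] and [d] add. *)
Definition code_prod (C D : seq (seq (option bool))) := [seq u ++ v | u <- C, v <- D].

Fixpoint bit_words m : seq (seq (option bool)) :=
  if m is m'.+1 then code_prod [:: [:: Some false]; [:: Some true]] (bit_words m')
  else [:: [::]].

(** Three rectangles in the plane, any two meeting in a segment; the third power gives 27. *)
Definition plane_code : seq (seq (option bool)) :=
  [:: [:: Some false; None]; [:: Some true; Some false]; [:: Some true; Some true]].

(* For m even. The vertices v of the middle layer come in antipodal pairs, told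
   apart by their first coordinate, so that the edges over antipodal v are not
   parallel. *)
Definition layer_code m : seq (seq (option bool)) :=
  flatten [seq
    let ones := count_mem (Some true) v in
    if ones < m./2 then code_prod [:: v] (bit_words 2)
    else if m./2 < ones then [:: v ++ [:: None; None]]
    else if head None v == Some true then
      [:: v ++ [:: Some false; None]; v ++ [:: Some true; None]]
    else [:: v ++ [:: None; Some false]; v ++ [:: None; Some true]]
  | v <- bit_words m].

Lemma code_3_5 : exists w : 'I_18 -> word 5, neighborly_code 3 w.
Proof.
by apply: (@list_codeP _ _ _ (code_prod (bit_words 1) (layer_code 2))); vm_compute.
Qed.

Lemma code_4_6 : exists w : 'I_37 -> word 6, neighborly_code 4 w.
Proof. by apply: (@list_codeP _ _ _ (layer_code 4)); vm_compute. Qed.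

Lemma code_3_6 : exists w : 'I_27 -> word 6, neighborly_code 3 w.
Proof.
apply: (@list_codeP _ _ _ (code_prod plane_code (code_prod plane_code plane_code)));
by vm_compute.
Qed.

Lemma code_5_7 : exists w : 'I_74 -> word 7, neighborly_code 5 w.
Proof.
by apply: (@list_codeP _ _ _ (code_prod (bit_words 1) (layer_code 4))); vm_compute.
Qed.

Lemma code_6_8 : exists w : 'I_150 -> word 8, neighborly_code 6 w.
Proof. by apply: (@list_codeP _ _ _ (layer_code 6)); vm_compute. Qed.

(** * Boxes, their dimensions and their intersections *)

Section Geometry.
Local Open Scope classical_set_scope.
Local Open Scope ring_scope.

Section Boxes.
Variables (R : realType) (d : nat).
Implicit Types a b : 'I_d -> R.

Definition box a b : set 'rV[R]_d := [set x | forall i, a i <= x ord0 i <= b i].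

Lemma standard_boxP (K : set 'rV[R]_d) :
  standard_box K <-> exists a b, (forall i, a i <= b i) /\ K = box a b.
Proof.
split=> [[I [/choice[a /choice[b ab]] ->]]|[a [b [ab ->]]]].
  exists a, b; split=> [i|]; first by case: (ab i).
  apply/seteqP; split=> x /= xI i; have := xI i.
    by rewrite (ab i).2 /= in_itv.
  by rewrite (ab i).2 /= in_itv.
exists (fun i => `[a i, b i]%classic); split=> [i|]; first by exists (a i), (b i).
by apply/seteqP; split=> x /= xI i; have := xI i; rewrite /= in_itv.
Qed.

Lemma has_dim_inj (A : set 'rV[R]_d) j j' : has_dim A j -> has_dim A j' -> j = j'.
Proof.
move=> [_ [V [AV minV <-]]] [_ [V' [AV' minV' <-]]].
by apply/eqP; rewrite eqn_leq !dimvS ?minV ?minV'.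
Qed.

Definition axes (s : seq 'I_d) : {vspace 'rV[R]_d} :=
  <<[seq delta_mx ord0 i | i <- s]>>%VS.

Lemma mem_axes s (x : 'rV[R]_d) : (forall i, i \notin s -> x ord0 i = 0) -> x \in axes s.
Proof.
move=> x0; rewrite (row_sum_delta x); apply: memv_suml => i _.
have [iS|/x0 ->] := boolP (i \in s); last by rewrite scale0r mem0v.
by apply/memvZ/memv_span/map_f.
Qed.

(** The unit vectors of [S] and of its complement are [d] vectors spanning the space, hence free,
    and so is the subfamily of [S]. *)
Lemma dim_axes (S : pred 'I_d) : \dim (axes (enum S)) = #|S|.
Proof.
have full : axes (enum S ++ enum (predC S)) = fullv.
  apply/vspaceP => x; rewrite memvf mem_axes // => i.
  by rewrite mem_cat !mem_enum !inE orbN.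
have : free [seq delta_mx ord0 i : 'rV[R]_d | i <- enum S ++ enum (predC S)].
  rewrite /free -/(axes _) full dimvf dim_matrix.
  rewrite -[eqbLHS]/(muln 1 d) mul1n size_map size_cat -!cardE.
  by rewrite cardC card_ord.
by rewrite map_cat => /catl_free/eqP; rewrite size_map -cardE.
Qed.

Lemma box_dim a b : (forall i, a i <= b i) ->
  has_dim (box a b) #|[pred i | a i < b i]|.
Proof.
move=> ab; split; first by exists (\row_i a i) => i /=; rewrite mxE lexx ab.
exists (axes (enum [pred i | a i < b i])); split; last exact: dim_axes.
  move=> x y xI yI; apply: mem_axes => i; rewrite mem_enum inE -leNgt => ba.
  rewrite !mxE; have /andP[ax xb] := xI i; have /andP[ay yb] := yI i; lra.
move=> W diffW; apply/span_subvP => _ /mapP[i + ->].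
rewrite mem_enum inE => abi; have ba0 : b i - a i != 0 by rewrite subr_eq0 gt_eqF.
rewrite -[delta_mx _ _]scale1r -(mulVf ba0) -scalerA memvZ //.
(* Moving the lower corner along side [i] to its other end stays in the box and gives a multiple of
   the unit vector. *)
have -> : (b i - a i) *: delta_mx ord0 i
          = \row_j (if j == i then b j else a j) - \row_j a j :> 'rV[R]_d.
  apply/rowP => j; rewrite !mxE eqxx /=.
  by case: eqVneq => [->|_]; rewrite ?mulr1 // mulr0 subrr.
apply: diffW => j; rewrite mxE ?lexx ?ab //.
by case: ifP; rewrite ?lexx ?ab.
Qed.

Lemma boxI a b a' b' : box a b `&` box a' b' =
  box (fun i => Num.max (a i) (a' i)) (fun i => Num.min (b i) (b' i)).
Proof.
apply/seteqP; split=> x /=.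
  case=> xI xI' i; rewrite ge_max le_min.
  by have /andP[-> ->] := xI i; have /andP[-> ->] := xI' i.
move=> xI; split=> i; have := xI i; rewrite ge_max le_min.
  by case/andP=> /andP[-> _] /andP[-> _].
by case/andP=> /andP[_ ->] /andP[_ ->].
Qed.

Lemma box_nonempty a b : box a b !=set0 -> forall i, a i <= b i.
Proof. by move=> [x xI] i; have /andP[] := xI i; exact: le_trans. Qed.

End Boxes.

(* By Helly's theorem all contacts take place at one point: label an interval by
   whether it ends there, starts there, or neither. *)
Lemma interval_labels (R : realType) n (a b : 'I_n -> R) :
    (forall i, a i < b i) -> (forall i j, a i <= b j) ->
  exists l : 'I_n -> option bool,
    forall i j, clash (l i) (l j) = ~~ (Num.max (a i) (a j) < Num.min (b i) (b j)).
Proof.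
move=> lt_ab le_ab.
exists (fun i => if [exists j, b i == a j] then Some false
                 else if [exists j, a i == b j] then Some true else None).
move=> i j; rewrite gt_max !lt_min !lt_ab /= andbT negb_and -!leNgt /clash.
have eq_end x y : (b x <= a y) -> b x = a y by move=> h; apply/le_anti; rewrite h le_ab.
(* An interval starting at a contact cannot also end at one: a common value [b y = a z] would be at
   most [b x], hence at most [a y]. *)
have start x y : b x <= a y -> [exists z, b y == a z] = false.
  move=> xy; apply/negbTE/negP => /fintype.existsP[z /eqP yz].
  have := lt_le_trans (lt_ab y) (_ : b y <= b x).
  by rewrite ltNge xy yz le_ab => /(_ isT).
have pos x y : b x <= a y -> [exists z, b x == a z].
  by move=> /eq_end xy; apply/fintype.existsP; exists y; rewrite xy.
have pos' x y : b x <= a y -> [exists z, a y == b z].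
  by move=> /eq_end xy; apply/fintype.existsP; exists x; rewrite xy.
(* Every start is at most every end, so opposite labels force a contact. *)
have touch x y z z' : b x = a z -> a y = b z' -> b x <= a y.
  by move=> -> ->; exact: le_ab.
case: (boolP (b j <= a i)) => [ji|nji].
  by rewrite (start _ _ ji) (pos' _ _ ji) (pos _ _ ji).
case: (boolP (b i <= a j)) => [ij|nij].
  by rewrite (start _ _ ij) (pos' _ _ ij) (pos _ _ ij).
case: fintype.existsP => [[z /eqP iz]|_]; case: fintype.existsP => [[z' /eqP jz']|_] //.
- case: fintype.existsP => [[t /eqP jt]|_] //.
  by rewrite (touch _ _ _ _ iz jt) in nij.
- case: fintype.existsP => [[t /eqP jt]|_]; last by case: fintype.existsP.
  by rewrite (touch _ _ _ _ jt jz') in nji.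
Qed.

(** * Translation between neighborly families and codes *)

Section Families.
Variables (R : realType) (k d : nat).

Lemma card_box_meet (a b a' b' : 'I_d -> R) (u v : word d) :
    (forall i, clash (u i) (v i)
               = ~~ (Num.max (a i) (a' i) < Num.min (b i) (b' i))) ->
  #|[pred i | Num.max (a i) (a' i) < Num.min (b i) (b' i)]| = (d - clashes u v)%N.
Proof.
move=> uv; have := cardC [pred i | clash (u i) (v i)]; rewrite card_ord.
have -> : #|[pred i | clash (u i) (v i)]| = clashes u v.
  by rewrite -sum1_card big_mkcond; apply: eq_bigr => i _; rewrite inE; case: clash.
have -> : #|predC [pred i | clash (u i) (v i)]|
          = #|[pred i | Num.max (a i) (a' i) < Num.min (b i) (b' i)]|.
  by apply: eq_card => i; rewrite !inE uv negbK.
lia.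
Qed.

Lemma code_neighborly_size n (w : 'I_n -> word d) :
  neighborly_code k w -> neighborly_size R k d n.
Proof.
move=> code.
(* Labels 0, 1 and star become the intervals [-1, 0], [0, 1] and [-1, 1], all containing 0. *)
pose a i l : R := if w i l is Some true then 0 else -1.
pose b i l : R := if w i l is Some false then 0 else 1.
have lt_ab i l : a i l < b i l by rewrite /a /b; case: (w i l) => [[]|]; lra.
have meet i j l : clash (w i l) (w j l)
    = ~~ (Num.max (a i l) (a j l) < Num.min (b i l) (b j l)).
  rewrite gt_max !lt_min !lt_ab /a /b.
  case: (w i l) => [[]|]; case: (w j l) => [[]|]; rewrite /= ?ltxx ?andbF //;
  by apply/esym/negbTE; rewrite negbK; apply/andP; split; lra.
have le_meet i j l : Num.max (a i l) (a j l) <= Num.min (b i l) (b j l).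
  rewrite ge_max !le_min !(ltW (lt_ab _ _)) /a /b /= andbT.
  by apply/andP; split; case: (w i l) => [[]|]; case: (w j l) => [[]|]; lra.
have dim_meet i j : has_dim (box (a i) (b i) `&` box (a j) (b j))
                      (d - clashes (w i) (w j)).
  by rewrite boxI -(card_box_meet (meet i j)); apply: box_dim.
have dim_box i : has_dim (box (a i) (b i)) d.
  by have := dim_meet i i; rewrite setIid clashesxx subn0.
have box_inj i j : box (a i) (b i) = box (a j) (b j) -> i = j.
  move=> ij; apply/eqP; apply: contraT => /code cij.
  have := dim_meet i j; rewrite ij setIid => /(has_dim_inj (dim_box j)).
  by have := clashes_leq (w i) (w j); lia.
exists [set box (a i) (b i) | i in [set: 'I_n]]; split; last first.
  rewrite (card_eqr card_II); apply: inj_card_eq => i j _ _; exact: box_inj.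
split; first exact: finite_image.
  move=> _ [i _ <-]; split=> //; apply/standard_boxP; exists (a i), (b i); split=> // l.
  exact: ltW.
move=> _ _ [i _ <-] [j _ <-] ij; exists (d - clashes (w i) (w j))%N.
split=> //; have : i != j by apply: contra_not_neq ij => ->.
move=> /code; lia.
Qed.

Lemma neighborly_size_code n : (0 < d)%N ->
  neighborly_size R k d n -> exists w : 'I_n -> word d, neighborly_code k w.
Proof.
move=> d0 [F [[_ Fbox Fmeet]]]; rewrite card_eq_sym => /card_set_bijP[f [fF finj _]].
have Ff (i : 'I_n) : F (f i) by exact/fF/ltn_ord.
have /choice[a /choice[b ab]] (i : 'I_n) : exists a b : 'I_d -> R,
    (forall l, a l < b l) /\ f i = box a b.
  have [/standard_boxP[a [b [ab fi]]] dimf] := Fbox _ (Ff i).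
  exists a, b; split=> // l; move: dimf; rewrite fi => dimf.
  (* Full dimension means that the nondegenerate sides number [d], so all sides are
     nondegenerate. *)
  have := has_dim_inj dimf (box_dim ab); rewrite -[LHS]card_ord => cardE.
  have /subset_cardP/(_ (subset_predT _))/(_ l) := esym cardE.
  by rewrite !inE.
have lt_ab i l : a i l < b i l by case: (ab i).
have fE (i : 'I_n) : f i = box (a i) (b i) by case: (ab i).
have f_neq (i j : 'I_n) : i != j -> f i <> f j.
  move=> ij eq_f; move/eqP: ij; apply; apply/val_inj.
  by apply: finj eq_f; rewrite inE /=; exact: ltn_ord.
have le_meet (i j : 'I_n) l : Num.max (a i l) (a j l) <= Num.min (b i l) (b j l).
  have [<-|/f_neq ij] := eqVneq i j; first by rewrite maxxx minxx ltW.
  have [m [_ [ne _]]] := Fmeet _ _ (Ff i) (Ff j) ij.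
  by move: ne; rewrite !fE boxI => /box_nonempty.
have le_ab l i j : a i l <= b j l.
  by have := le_meet i j l; rewrite ge_max !le_min => /andP[/andP[_ ->]].
have /choice[w meet] l := interval_labels (fun i => lt_ab i l) (le_ab l).
exists (fun i l => w l i) => i j /f_neq ij.
have [m [m_range]] := Fmeet _ _ (Ff i) (Ff j) ij; rewrite !fE boxI.
move=> /(has_dim_inj (box_dim (le_meet i j))).
rewrite (card_box_meet (u := w^~ i) (v := w^~ j)) //.
(* Subtraction is truncated: [d0] turns dimension at most [d - 1] into a clash, and clashes being at
   most [d] gives the bound [k]. *)
by have := clashes_leq (w^~ i) (w^~ j); lia.
Qed.

Lemma max_neighborly_bounds lo hi : (0 < d)%N ->
    (exists w : 'I_lo -> word d, neighborly_code k w) ->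
    (forall n (w : 'I_n -> word d), neighborly_code k w -> (n <= hi)%N) ->
  (lo <= max_neighborly R k d <= hi)%N.
Proof.
move=> d0 [wlo lo_code] hi_code.
have hiP n : neighborly_size R k d n -> (n <= hi)%N.
  by move=> /(neighborly_size_code d0)[w /hi_code].
have loP := code_neighborly_size lo_code.
pose P n := `[< neighborly_size R k d n >].
have exP : exists n, P n by exists lo; apply/asboolP.
have leP n : P n -> (n <= hi)%N by move=> /asboolP/hiP.
have [m /asboolP mP mmax] := ex_maxnP exP leP.
(* The sizes are bounded and [lo] is attained, so a maximum exists and [xget] does not fall back to
   its default 0. *)
have [M maxM] : is_max_size R k d (max_neighborly R k d).
  by apply: xgetPex; exists m; split=> // m' /asboolP; exact: mmax.
by rewrite maxM //= hiP.
Qed.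

End Families.

End Geometry.

Theorem corollary1p7 (R : realType) :
  [/\ max_neighborly R 3 5 = 18%N,
      max_neighborly R 4 6 = 37%N,
      (27 <= max_neighborly R 3 6 <= 28)%N,
      (74 <= max_neighborly R 5 7 <= 75)%N
    & (150 <= max_neighborly R 6 8 <= 151)%N].
Proof.
split.
- apply/anti_leq; rewrite andbC.
  exact: max_neighborly_bounds _ code_3_5 code_size_3_5.
- apply/anti_leq; rewrite andbC.
  exact: max_neighborly_bounds _ code_4_6 code_size_4_6.
- exact: max_neighborly_bounds _ code_3_6 code_size_3_6.
- exact: max_neighborly_bounds _ code_5_7 code_size_5_7.
- exact: max_neighborly_bounds _ code_6_8 code_size_6_8.
Qed.
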